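(* Every $\ell_\infty$-embeddable algebra and every $\ell_\infty$-embeddable Banach space is $(B(\ell_2)\setminus\mathcal{K}(\ell_2))$-embeddable.
   Context: All algebras are associative and complex; $\ell_\infty$ is the $C^*$-algebra of bounded complex sequences, $B(\ell_2)$ the $C^*$-algebra of bounded operators on the complex Hilbert space $\ell_2(\mathbb{N})$, and $\mathcal{K}(\ell_2)$ the ideal of compact operators. Let $B$ be a $C^*$-algebra. A $B$-embedding of $A$ is an injective linear map $\phi\colon A\to B$ preserving the structure of $A$: isometric if $A$ is a Banach space; an algebra homomorphism if $A$ is an algebra; isometric and an algebra homomorphism if $A$ is a Banach algebra; a $^*$-homomorphism if $A$ is a $C^*$-algebra. $A$ is $B$-embeddable if a $B$-embedding of $A$ exists. For $Y\subset B$, $A$ is $(B\setminus Y)$-embeddable if there is a $B$-embedding $\phi$ of $A$ with $\phi(A)\cap Y=\{0\}$. *)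

(* Defs.v *)
From HB Require Import structures.
From mathcomp Require Import all_boot all_order all_algebra.
From mathcomp Require Import complex ring.
From mathcomp Require Import all_classical all_reals all_analysis.
Import Order.TTheory GRing.Theory Num.Theory.
Import numFieldNormedType.Exports.

Set Implicit Arguments.
Unset Strict Implicit.
Unset Printing Implicit Defensive.

Local Open Scope classical_set_scope.
Local Open Scope ring_scope.

(* Associative algebras, not assumed to have a unit: the [algType]s of
   MathComp are unital and nontrivial, so they are not general enough. *)
HB.mixin Record Lmodule_isAssocAlgebra (K : comNzRingType) A
    of GRing.Lmodule K A := {
  amul : A -> A -> A;
  amulA : associative amul;
  amulDl : left_distributive amul +%R;
  amulDr : right_distributive amul +%R;
  scaler_amull : forall (k : K) (x y : A), k *: amul x y = amul (k *: x) y;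
  scaler_amulr : forall (k : K) (x y : A), k *: amul x y = amul x (k *: y)
}.

#[short(type="assocAlgType")]
HB.structure Definition AssocAlgebra (K : comNzRingType) :=
  {A of GRing.Lmodule K A & Lmodule_isAssocAlgebra K A}.

(* The norm of a [normedModType R[i]] is valued in [R[i]]; this is the same
   norm as an element of [R]. *)
Definition rnorm (R : realType) (V : normedModType R[i]) (x : V) : R :=
  complex.Re `|x|.

Section rnorm_theory.
Variables (R : realType) (V : normedModType R[i]).
Implicit Types x y : V.

Lemma rnormE x : `|x| = (rnorm x)%:C%C.
Proof.
have := normr_ge0 x; rewrite /rnorm; case: `|x| => a b.
by rewrite lecE /= => /andP[/eqP -> _].
Qed.

Lemma rnorm_ge0 x : 0 <= rnorm x.
Proof. by have := normr_ge0 x; rewrite rnormE lecR. Qed.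

Lemma rnormD x y : rnorm (x + y) <= rnorm x + rnorm y.
Proof. by have := ler_normD x y; rewrite !rnormE -rmorphD lecR. Qed.

Lemma rnorm0 : rnorm (0 : V) = 0.
Proof. by rewrite /rnorm normr0. Qed.

Lemma rnorm0_eq0 x : rnorm x = 0 -> x = 0.
Proof. by move=> x0; apply/eqP; rewrite -normr_eq0 rnormE x0. Qed.

End rnorm_theory.

Section rnorm_complex.
Variable R : realType.

Lemma normc_rnorm (k : R[i]) : `|k| = (rnorm (k : R[i]^o))%:C%C.
Proof. exact: (rnormE (k : R[i]^o)). Qed.

Lemma rnormZ (V : normedModType R[i]) (k : R[i]) (x : V) :
  rnorm (k *: x) = rnorm (k : R[i]^o) * rnorm x.
Proof.
by have := normrZ k x; rewrite normc_rnorm !rnormE -rmorphM => -[].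
Qed.

Lemma rnormM (x y : R[i]) :
  rnorm (x * y : R[i]^o) = rnorm (x : R[i]^o) * rnorm (y : R[i]^o).
Proof. exact: (rnormZ x (y : R[i]^o)). Qed.

End rnorm_complex.

Section linf.
Variable R : realType.

Definition linf_pred : {pred nat -> R[i]^o} := fun f => `[< bounded_fun f >].

Record linf := Linf {
  linf_seq :> nat -> R[i]^o;
  _ : linf_seq \in linf_pred
}.

HB.instance Definition _ := [isSub for linf_seq].
HB.instance Definition _ := [Choice of linf by <:].

Lemma bounded_seqP (f : nat -> R[i]^o) :
  bounded_fun f <-> exists M : R, forall n, rnorm (f n) <= M.
Proof.
have PF : ProperFilter (globally [set: nat]) by exact: (@globally_properfilter _ _ 0%N).
rewrite /= ex_bound; split.
  move=> [M fM].
  exists (complex.Re M) => n; have /= := fM n Logic.I.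
  by rewrite normc_rnorm lecE => /andP[_].
move=> [M fM]; exists M%:C%C => n _ /=.
by rewrite normc_rnorm lecR.
Qed.

Lemma linf_submod_closed : submod_closed linf_pred.
Proof.
split.
  by apply/asboolP/bounded_seqP; exists 0 => n; rewrite rnorm0.
move=> k f g /asboolP/bounded_seqP[M fM] /asboolP/bounded_seqP[N gN].
apply/asboolP/bounded_seqP; exists (rnorm (k : R[i]^o) * M + N) => n.
rewrite (le_trans (rnormD _ _))// lerD//.
by rewrite (rnormZ k (f n : R[i]^o)) ler_wpM2l ?rnorm_ge0.
Qed.

HB.instance Definition _ := GRing.isSubmodClosed.Build _ _ linf_pred
  linf_submod_closed.
HB.instance Definition _ := [SubChoice_isSubLmodule of linf by <:].

Lemma linfP (f : linf) : exists M : R, forall n, rnorm (f n) <= M.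
Proof. by apply/bounded_seqP; case: f => f /= /asboolP. Qed.

Lemma linf_eqP (f g : linf) : (forall n, f n = g n) -> f = g.
Proof. by move=> fg; apply/val_inj/funext => n /=; exact: fg. Qed.

Lemma linf_mul_subproof (f g : linf) :
  (fun n => f n * g n : R[i]^o) \in linf_pred.
Proof.
have [[M fM] [N gN]] := (linfP f, linfP g).
apply/asboolP/bounded_seqP; exists (M * N) => n.
by rewrite rnormM ler_pM ?rnorm_ge0.
Qed.

Definition linf_mul (f g : linf) : linf := Linf (linf_mul_subproof f g).

Lemma linf_mulA : associative linf_mul.
Proof. by move=> f g h; apply: linf_eqP => n /=; exact: mulrA. Qed.

Lemma linf_mulDl : left_distributive linf_mul +%R.
Proof. by move=> f g h; apply: linf_eqP => n /=; exact: mulrDl. Qed.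

Lemma linf_mulDr : right_distributive linf_mul +%R.
Proof. by move=> f g h; apply: linf_eqP => n /=; exact: mulrDr. Qed.

Lemma linf_scalel (k : R[i]) (f g : linf) :
  k *: linf_mul f g = linf_mul (k *: f) g.
Proof. by apply: linf_eqP => n /=; exact: mulrA. Qed.

Lemma linf_scaler (k : R[i]) (f g : linf) :
  k *: linf_mul f g = linf_mul f (k *: g).
Proof. by apply: linf_eqP => n /=; exact: mulrCA. Qed.

HB.instance Definition _ := Lmodule_isAssocAlgebra.Build R[i] linf
  linf_mulA linf_mulDl linf_mulDr linf_scalel linf_scaler.

Definition linf_rnorm (f : linf) : R := sup (range (fun n => rnorm (f n))).

Lemma linf_rnorm_ub (f : linf) n : rnorm (f n) <= linf_rnorm f.
Proof.
have [M fM] := linfP f; apply: ub_le_sup; last by exists n.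
by exists M => _ [m _ <-].
Qed.

Lemma linf_rnorm_le (f : linf) M :
  (forall n, rnorm (f n) <= M) -> linf_rnorm f <= M.
Proof.
move=> fM; apply: ge_sup; first by exists (rnorm (f 0%N)), 0%N.
by move=> _ [n _ <-].
Qed.

Definition linf_norm (f : linf) : R[i] := (linf_rnorm f)%:C%C.

Lemma linf_normD (f g : linf) : linf_norm (f + g) <= linf_norm f + linf_norm g.
Proof.
rewrite /linf_norm -rmorphD lecR; apply: linf_rnorm_le => n.
by rewrite (le_trans (rnormD _ _))// lerD ?linf_rnorm_ub.
Qed.

Lemma linf_normZ (k : R[i]) (f : linf) : linf_norm (k *: f) = `|k| * linf_norm f.
Proof.
have H (l : R[i]) (g : linf) :
    linf_rnorm (l *: g) <= rnorm (l : R[i]^o) * linf_rnorm g.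
  apply: linf_rnorm_le => n.
  by rewrite (rnormZ l (g n : R[i]^o)) ler_wpM2l ?rnorm_ge0 ?linf_rnorm_ub.
rewrite /linf_norm normc_rnorm -rmorphM; congr (_%:C%C).
apply/le_anti; rewrite H /=.
have [->|k0] := eqVneq k 0.
  rewrite rnorm0 mul0r.
  exact: le_trans (rnorm_ge0 _) (linf_rnorm_ub _ 0%N).
have := H k^-1 (k *: f); rewrite scalerA mulVf// scale1r => /(ler_wpM2l (rnorm_ge0 (k : R[i]^o))).
by rewrite mulrA -rnormM divff// /rnorm normr1 mul1r.
Qed.

Lemma linf_norm0_eq0 (f : linf) : linf_norm f = 0 -> f = 0.
Proof.
move=> [f0]; apply: linf_eqP => n; apply: (@rnorm0_eq0 R R[i]^o).
by apply/le_anti; rewrite rnorm_ge0 andbT -f0 linf_rnorm_ub.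
Qed.

HB.instance Definition _ := Lmodule_isNormed.Build R[i] linf
  linf_normD linf_normZ linf_norm0_eq0.

End linf.

Section ell2.
Variable R : realType.

(* The norm of [ell2] is written directly as the one induced by the inner
   product sum_n x_n (y_n)^*. *)
Definition sqsum (x : nat -> R[i]^o) : \bar R :=
  (\sum_(0 <= n <oo) (rnorm (x n) ^+ 2)%:E)%E.

Definition ell2_pred : {pred nat -> R[i]^o} := fun x => (sqsum x < +oo)%E.

Record ell2 := Ell2 {
  ell2_seq :> nat -> R[i]^o;
  _ : ell2_seq \in ell2_pred
}.

HB.instance Definition _ := [isSub for ell2_seq].
HB.instance Definition _ := [Choice of ell2 by <:].

Lemma sqsum_ge0 x : (0 <= sqsum x)%E.
Proof. by apply: nneseries_ge0 => n _ _; rewrite lee_fin sqr_ge0. Qed.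

Lemma sqsumZ (k : R[i]) (x : nat -> R[i]^o) :
  sqsum (k *: x) = ((rnorm (k : R[i]^o) ^+ 2)%:E * sqsum x)%E.
Proof.
rewrite /sqsum -nneseriesZl; last by move=> n _; rewrite lee_fin sqr_ge0.
apply: eq_eseriesr => n _.
by rewrite (rnormZ k (x n : R[i]^o)) exprMn EFinM.
Qed.

Lemma sqsumD_le (x y : nat -> R[i]^o) (a b : R) : 0 < a -> 0 < b ->
  (sqsum x <= (a ^+ 2)%:E -> sqsum y <= (b ^+ 2)%:E ->
   sqsum (x + y)%R <= ((a + b) ^+ 2)%:E)%E.
Proof.
move=> a0 b0 xa yb.
have c0 : 0 <= 1 + b / a by rewrite addr_ge0// divr_ge0// ltW.
have d0 : 0 <= 1 + a / b by rewrite addr_ge0// divr_ge0// ltW.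
apply: (@le_trans _ _ ((1 + b / a)%:E * sqsum x + (1 + a / b)%:E * sqsum y)%E).
  rewrite /sqsum -!nneseriesZl; try by move=> n _; rewrite lee_fin sqr_ge0.
  rewrite -nneseriesD; try by move=> n _ _; rewrite -EFinM lee_fin mulr_ge0 ?sqr_ge0.
  apply: lee_nneseries => [n _ _|n _]; first by rewrite lee_fin sqr_ge0.
  rewrite -!EFinM -EFinD lee_fin.
  apply: (@le_trans _ _ ((rnorm (x n) + rnorm (y n)) ^+ 2)).
    by rewrite ler_sqr ?nnegrE ?addr_ge0 ?rnorm_ge0 ?rnormD.
  set u := rnorm (x n); set v := rnorm (y n).
  rewrite -subr_ge0 (_ : _ - _ = (b * u - a * v) ^+ 2 / (a * b)).
    by rewrite divr_ge0 ?sqr_ge0 ?mulr_ge0 ?ltW.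
  by field; rewrite !gt_eqF.
apply: (@le_trans _ _ ((1 + b / a)%:E * (a ^+ 2)%:E + (1 + a / b)%:E * (b ^+ 2)%:E)%E).
  by rewrite leeD// lee_wpmul2l// lee_fin.
rewrite -!EFinM -EFinD lee_fin le_eqVlt; apply/orP; left; apply/eqP.
by field; rewrite !gt_eqF.
Qed.

Definition ell2_rnorm (x : nat -> R[i]^o) : R := Num.sqrt (fine (sqsum x)).

Lemma ell2_rnorm_ge0 x : 0 <= ell2_rnorm x.
Proof. exact: sqrtr_ge0. Qed.

Lemma sqsumE (x : nat -> R[i]^o) : (sqsum x < +oo)%E ->
  sqsum x = (ell2_rnorm x ^+ 2)%:E.
Proof.
move=> xoo; rewrite /ell2_rnorm sqr_sqrtr ?fine_ge0 ?sqsum_ge0//.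
by rewrite fineK// ge0_fin_numE ?sqsum_ge0.
Qed.

Lemma ell2_rnorm_le (x : nat -> R[i]^o) (a : R) : 0 <= a ->
  (sqsum x <= (a ^+ 2)%:E)%E -> ell2_rnorm x <= a.
Proof.
move=> a0 xa; rewrite -ler_sqr ?nnegrE ?ell2_rnorm_ge0// -lee_fin -sqsumE//.
exact: le_lt_trans xa (ltry _).
Qed.

Lemma ell2_submod_closed : submod_closed ell2_pred.
Proof.
split.
  rewrite unfold_in /= /sqsum eseries0// => n _ _.
  by rewrite rnorm0 expr0n.
move=> k x y; rewrite !unfold_in => xoo yoo.
have kxoo : (sqsum (k *: x) < +oo)%E.
  by rewrite sqsumZ sqsumE// -EFinM ltry.
have p (z : nat -> R[i]^o) : 0 < ell2_rnorm z + 1.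
  by rewrite ltr_wpDl// ell2_rnorm_ge0.
have le (z : nat -> R[i]^o) : (sqsum z < +oo)%E ->
    (sqsum z <= ((ell2_rnorm z + 1) ^+ 2)%:E)%E.
  move=> zoo; rewrite sqsumE// lee_fin ler_sqr ?nnegrE ?ell2_rnorm_ge0//.
    by rewrite lerDl.
  exact: ltW.
exact: le_lt_trans (sqsumD_le (p _) (p _) (le _ kxoo) (le _ yoo)) (ltry _).
Qed.

HB.instance Definition _ := GRing.isSubmodClosed.Build _ _ ell2_pred
  ell2_submod_closed.
HB.instance Definition _ := [SubChoice_isSubLmodule of ell2 by <:].

Lemma ell2P (x : ell2) : (sqsum x < +oo)%E.
Proof. by case: x. Qed.

Definition ell2_norm (x : ell2) : R[i] := (ell2_rnorm x)%:C%C.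

Lemma ell2_normD (x y : ell2) : ell2_norm (x + y) <= ell2_norm x + ell2_norm y.
Proof.
rewrite /ell2_norm -rmorphD lecR; apply/ler_addgt0Pr => e e0.
have e20 : 0 < e / 2 by rewrite divr_gt0.
rewrite (_ : _ + e = (ell2_rnorm x + e / 2) + (ell2_rnorm y + e / 2)); last first.
  by field.
have p (z : nat -> R[i]^o) : 0 < ell2_rnorm z + e / 2.
  by rewrite ltr_wpDl// ell2_rnorm_ge0.
have le (z : ell2) : (sqsum z <= ((ell2_rnorm z + e / 2) ^+ 2)%:E)%E.
  rewrite sqsumE ?ell2P// lee_fin ler_sqr ?nnegrE ?ell2_rnorm_ge0//.
    by rewrite lerDl ltW.
  exact: ltW.
apply: ell2_rnorm_le; first by rewrite addr_ge0// ltW.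
exact: sqsumD_le (p _) (p _) (le x) (le y).
Qed.

Lemma ell2_normZ (k : R[i]) (x : ell2) : ell2_norm (k *: x) = `|k| * ell2_norm x.
Proof.
rewrite /ell2_norm normc_rnorm -rmorphM; congr (_%:C%C).
rewrite /ell2_rnorm (sqsumZ k x) (sqsumE (ell2P x)) -EFinM /= -exprMn.
by rewrite !sqrtr_sqr !ger0_norm ?mulr_ge0 ?rnorm_ge0 ?ell2_rnorm_ge0.
Qed.

Lemma ell2_coord_le (x : ell2) n : rnorm (x n) <= ell2_rnorm x.
Proof.
rewrite -ler_sqr ?nnegrE ?ell2_rnorm_ge0 ?rnorm_ge0//.
rewrite -lee_fin -(sqsumE (ell2P x)) /sqsum (@nneseriesD1 _ _ n)//; last first.
  by move=> m _; rewrite lee_fin sqr_ge0.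
by rewrite leeDl// nneseries_ge0// => m _ _; rewrite lee_fin sqr_ge0.
Qed.

Lemma ell2_norm0_eq0 (x : ell2) : ell2_norm x = 0 -> x = 0.
Proof.
move=> [x0]; apply/val_inj/funext => n; apply: (@rnorm0_eq0 R R[i]^o).
by apply/le_anti; rewrite rnorm_ge0 andbT -x0 ell2_coord_le.
Qed.

HB.instance Definition _ := Lmodule_isNormed.Build R[i] ell2
  ell2_normD ell2_normZ ell2_norm0_eq0.

End ell2.

Section bounded_operators.
Variables (R : realType) (E : normedModType R[i]).

(* [bop] is the algebra B(E) of bounded operators on E, with composition as
   product and the operator norm. *)
Definition bop_pred : {pred E -> E} :=
  fun T => `[< linear T /\ continuous T >].

Record bop := Bop {
  bop_fun :> E -> E;
  _ : bop_fun \in bop_pred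
}.

HB.instance Definition _ := [isSub for bop_fun].
HB.instance Definition _ := [Choice of bop by <:].

Lemma bop_submod_closed : submod_closed bop_pred.
Proof.
split.
  apply/asboolP; split; last exact: cst_continuous.
  by move=> k x y; rewrite /= scaler0 addr0.
move=> k S T /asboolP[Sl Sc] /asboolP[Tl Tc]; apply/asboolP; split.
  move=> l x y; rewrite -![(_ + _ : E -> E) _]/(_ _ + _).
  rewrite -![(_ *: _ : E -> E) _]/(_ *: _) Sl Tl !scalerDr !scalerA.
  by rewrite (mulrC k) addrACA.
move=> x; apply: (@continuousD _ E E (k *: S) T x); last exact: Tc.
by apply: continuousZr; exact: Sc.
Qed.

HB.instance Definition _ := GRing.isSubmodClosed.Build _ _ bop_pred
  bop_submod_closed.
HB.instance Definition _ := [SubChoice_isSubLmodule of bop by <:].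

Lemma bop_linear (T : bop) : linear T.
Proof. by case: T => T /= /asboolP[]. Qed.

HB.instance Definition _ (T : bop) := GRing.isLinear.Build _ _ _ _ (bop_fun T)
  (@bop_linear T).

Lemma bop_continuous (T : bop) : continuous T.
Proof. by case: T => T /= /asboolP[]. Qed.

Lemma bop_eqP (S T : bop) : (forall x, S x = T x) -> S = T.
Proof. by move=> ST; apply/val_inj/funext => x /=; exact: ST. Qed.

Lemma bop_mul_subproof (S T : bop) : (S \o T) \in bop_pred.
Proof.
apply/asboolP; split; first by move=> k x y /=; rewrite !linearP.
by move=> x; apply: continuous_comp; exact: bop_continuous.
Qed.

Definition bop_mul (S T : bop) : bop := Bop (bop_mul_subproof S T).

Lemma bop_mulA : associative bop_mul.
Proof. by move=> S T U; apply: bop_eqP. Qed.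

Lemma bop_mulDl : left_distributive bop_mul +%R.
Proof. by move=> S T U; apply: bop_eqP. Qed.

Lemma bop_mulDr : right_distributive bop_mul +%R.
Proof. by move=> S T U; apply: bop_eqP => x; exact: (linearD S). Qed.

Lemma bop_scalel (k : R[i]) (S T : bop) :
  k *: bop_mul S T = bop_mul (k *: S) T.
Proof. by apply: bop_eqP. Qed.

Lemma bop_scaler (k : R[i]) (S T : bop) :
  k *: bop_mul S T = bop_mul S (k *: T).
Proof. by apply: bop_eqP => x; symmetry; exact: (linearZ_LR S). Qed.

HB.instance Definition _ := Lmodule_isAssocAlgebra.Build R[i] bop
  bop_mulA bop_mulDl bop_mulDr bop_scalel bop_scaler.

Lemma bopP (T : bop) : exists M : R, forall x, rnorm (T x) <= M * rnorm x.
Proof.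
have /linear_bounded_continuous/linear_boundedP/pinfty_ex_gt0 := @bop_continuous T.
move=> [M M0 TM]; exists (complex.Re M) => x; have := TM x.
have -> : M = (complex.Re M)%:C%C.
  by case: M M0 {TM} => a b; rewrite ltcE /= => /andP[/eqP -> _].
by rewrite !rnormE -rmorphM lecR.
Qed.

Definition bop_rnorm (T : bop) : R :=
  sup [set rnorm (T x) | x in [set x : E | `|x| <= 1]].

Lemma unit_ballE (x : E) : (`|x| <= 1) = (rnorm x <= 1).
Proof. by rewrite rnormE -lecR. Qed.

Lemma bop_rnorm_ub1 (T : bop) x : `|x| <= 1 -> rnorm (T x) <= bop_rnorm T.
Proof.
move=> x1; have [M TM] := bopP T; apply: ub_le_sup; last by exists x.
exists `|M| => _ [y /= y1 <-]; rewrite (le_trans (TM _))//.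
rewrite unit_ballE in y1.
by rewrite (le_trans (ler_wpM2r (rnorm_ge0 _) (ler_norm M)))// ler_piMr.
Qed.

Lemma bop_rnorm_le (T : bop) M :
  (forall x, `|x| <= 1 -> rnorm (T x) <= M) -> bop_rnorm T <= M.
Proof.
move=> TM; apply: ge_sup.
  by exists (rnorm (T 0)), 0 => //=; rewrite normr0.
by move=> _ [x x1 <-]; exact: TM.
Qed.

Lemma bop_rnorm_ge0 (T : bop) : 0 <= bop_rnorm T.
Proof.
have := @bop_rnorm_ub1 T 0; rewrite normr0 => /(_ ler01).
by apply: le_trans; exact: rnorm_ge0.
Qed.

Lemma bop_rnorm_ub (T : bop) x : rnorm (T x) <= bop_rnorm T * rnorm x.
Proof.
have [->|x0] := eqVneq x 0; first by rewrite linear0 rnorm0 mulr0.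
have nx0 : 0 < rnorm x.
  by rewrite lt_neqAle rnorm_ge0 andbT; apply: contra_neq x0 => /esym/rnorm0_eq0.
have nk : rnorm (((rnorm x)^-1)%:C%C : R[i]^o) = (rnorm x)^-1.
  have := normc_rnorm ((rnorm x)^-1)%:C%C.
  by rewrite ger0_norm ?lecR ?invr_ge0 ?rnorm_ge0// => -[].
have := @bop_rnorm_ub1 T (((rnorm x)^-1)%:C%C *: x).
rewrite unit_ballE linearZ /= !rnormZ nk mulVf ?gt_eqF// => /(_ (lexx _)).
by rewrite mulrC ler_pdivrMr.
Qed.

Definition bop_norm (T : bop) : R[i] := (bop_rnorm T)%:C%C.

Lemma bop_normD (S T : bop) : bop_norm (S + T) <= bop_norm S + bop_norm T.
Proof.
rewrite /bop_norm -rmorphD lecR; apply: bop_rnorm_le => x x1.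
by rewrite (le_trans (rnormD _ _))// lerD ?bop_rnorm_ub1.
Qed.

Lemma bop_normZ (k : R[i]) (T : bop) : bop_norm (k *: T) = `|k| * bop_norm T.
Proof.
have H (l : R[i]) (U : bop) :
    bop_rnorm (l *: U) <= rnorm (l : R[i]^o) * bop_rnorm U.
  apply: bop_rnorm_le => x x1.
  by rewrite (rnormZ l (U x)) ler_wpM2l ?rnorm_ge0 ?bop_rnorm_ub1.
rewrite /bop_norm normc_rnorm -rmorphM; congr (_%:C%C).
apply/le_anti; rewrite H /=.
have [->|k0] := eqVneq k 0; first by rewrite rnorm0 mul0r bop_rnorm_ge0.
have := H k^-1 (k *: T); rewrite scalerA mulVf// scale1r.
move=> /(ler_wpM2l (rnorm_ge0 (k : R[i]^o))).
by rewrite mulrA -rnormM divff// /rnorm normr1 mul1r.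
Qed.

Lemma bop_norm0_eq0 (T : bop) : bop_norm T = 0 -> T = 0.
Proof.
move=> [T0]; apply: bop_eqP => x; apply: rnorm0_eq0.
by apply/le_anti; rewrite rnorm_ge0 andbT (le_trans (bop_rnorm_ub _ _))// T0 mul0r.
Qed.

HB.instance Definition _ := Lmodule_isNormed.Build R[i] bop
  bop_normD bop_normZ bop_norm0_eq0.

(* [precompact C] in MathComp-Analysis: [closure C] is compact. *)
Definition compact_operators : set bop :=
  [set T | precompact (T @` [set x : E | `|x| <= 1])].

End bounded_operators.
Arguments compact_operators {R} E.

(* Only the part of the structure of the target that an embedding has to
   preserve is required of [B]: its product when [A] is an algebra, its norm
   when [A] is a Banach space. *)
Section embeddings.
Variable K : numFieldType.

Definition algebra_embedding (A B : assocAlgType K) (phi : {linear A -> B}) :=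
  injective phi /\ {morph phi : x y / amul x y}.

Definition algebra_embeddable (A B : assocAlgType K) :=
  exists phi : {linear A -> B}, algebra_embedding phi.

Definition algebra_embeddable_avoiding (A B : assocAlgType K) (Y : set B) :=
  exists phi : {linear A -> B},
    algebra_embedding phi /\ range phi `&` Y = [set 0].

Definition banach_embedding (A : completeNormedModType K)
    (B : normedModType K) (phi : {linear A -> B}) :=
  injective phi /\ forall x, `|phi x| = `|x|.

Definition banach_embeddable (A : completeNormedModType K)
    (B : normedModType K) :=
  exists phi : {linear A -> B}, banach_embedding phi.

Definition banach_embeddable_avoiding (A : completeNormedModType K)
    (B : normedModType K) (Y : set B) :=
  exists phi : {linear A -> B},
    banach_embedding phi /\ range phi `&` Y = [set 0].

End embeddings.
Arguments algebra_embeddable_avoiding {K} A B Y.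
Arguments banach_embeddable_avoiding {K} A B Y.

(* Main.v *)
Require Import Defs.
From HB Require Import structures.
From mathcomp Require Import all_boot all_order all_algebra.
From mathcomp Require Import complex.
From mathcomp Require Import all_classical all_reals all_analysis.
Import Order.TTheory GRing.Theory Num.Theory.
Import numFieldNormedType.Exports.

Set Implicit Arguments.
Unset Strict Implicit.
Unset Printing Implicit Defensive.

Local Open Scope ring_scope.

(** The algebra of bounded sequences itself embeds into the bounded operators
on l2, isometrically and multiplicatively, so that only 0 becomes compact;
every embedding into bounded sequences is then followed by this one.

The obvious embedding sends a sequence to the diagonal operator with that
diagonal: it is multiplicative, and isometric because a diagonal operator
multiplies each basis vector by the corresponding entry ([diagM],
[diag_norm]). It meets the compact operators, since the diagonal operators
of sequences tending to 0 are compact. So the sequence is first spread out: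
the naturals are cut into infinitely many infinite classes, and the k-th
entry is repeated at all the positions of the k-th class ([spread]). This
operation is again an isometric homomorphism, and every nonzero value of its
result occurs infinitely often. A diagonal operator that has the same nonzero
entry c at infinitely many positions maps the corresponding basis vectors,
which are of norm 1, to vectors at mutual distance at least |c|; no
subsequence of these converges, so the operator is not compact
([compact_diag_eq0]). *)

Section basis.
Variable R : realType.

Definition delta_seq (n : nat) : nat -> R[i]^o := fun m => (m == n)%:R.

Lemma sqsum_delta n : sqsum (delta_seq n) = 1%:E.
Proof.
rewrite /sqsum (@nneseriesD1 _ _ n)//; last first.
  by move=> m _; rewrite lee_fin sqr_ge0.
rewrite eseries0 ?adde0; last first.
  by move=> m _ mn; rewrite /delta_seq (negPf mn) rnorm0 expr0n.
by rewrite /delta_seq eqxx /rnorm normr1 /= expr1n.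
Qed.

Lemma delta_subproof n : delta_seq n \in @ell2_pred R.
Proof. by rewrite unfold_in sqsum_delta ltry. Qed.

Definition delta n : ell2 R := Ell2 (delta_subproof n).

Lemma rnorm_delta n : rnorm (delta n) = 1.
Proof.
rewrite -[rnorm _]/(ell2_rnorm (delta_seq n)) /ell2_rnorm sqsum_delta /=.
exact: sqrtr1.
Qed.

End basis.

Section diagonal.
Variable R : realType.
Implicit Types (g h : linf R) (x : ell2 R).

Definition diag_seq g (x : nat -> R[i]^o) : nat -> R[i]^o :=
  fun n => g n * x n.

Lemma linf_rnorm_ge0 g : 0 <= linf_rnorm g.
Proof. exact: le_trans (rnorm_ge0 _) (linf_rnorm_ub g 0%N). Qed.

Lemma sqsum_diag_le g x :
  (sqsum (diag_seq g x) <= ((linf_rnorm g * ell2_rnorm x) ^+ 2)%:E)%E.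
Proof.
rewrite exprMn EFinM -sqsumE ?ell2P// /sqsum.
rewrite -nneseriesZl; last by move=> n _; rewrite lee_fin sqr_ge0.
apply: lee_nneseries => [n _ _|n _]; first by rewrite lee_fin sqr_ge0.
rewrite -EFinM lee_fin -exprMn rnormM ler_sqr ?nnegrE ?mulr_ge0 ?rnorm_ge0//.
  by rewrite ler_wpM2r ?rnorm_ge0 ?linf_rnorm_ub.
exact: linf_rnorm_ge0.
Qed.

Lemma diag_seq_subproof g x : diag_seq g x \in @ell2_pred R.
Proof. by rewrite unfold_in (le_lt_trans (sqsum_diag_le g x)) ?ltry. Qed.

Definition diag_fun g x : ell2 R := Ell2 (diag_seq_subproof g x).

Lemma rnorm_diag_le g x : rnorm (diag_fun g x) <= linf_rnorm g * rnorm x.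
Proof.
apply: ell2_rnorm_le (sqsum_diag_le g x).
by rewrite mulr_ge0 ?linf_rnorm_ge0 ?ell2_rnorm_ge0.
Qed.

Lemma ell2_eqP x (y : ell2 R) : (forall n, x n = y n) -> x = y.
Proof. by move=> xy; apply/val_inj/funext => n /=; exact: xy. Qed.

Lemma diag_fun_linear g : linear (diag_fun g).
Proof.
move=> k x y; apply: ell2_eqP => n.
rewrite -[LHS]/(g n * (k * x n + y n)) -[RHS]/(k * (g n * x n) + g n * y n).
by rewrite mulrDr mulrCA.
Qed.

HB.instance Definition _ g := GRing.isLinear.Build _ _ _ _ (diag_fun g)
  (diag_fun_linear g).

Lemma diag_fun_continuous g : continuous (diag_fun g).
Proof.
apply: bounded_linear_continuous; apply/linear_boundedP.
near=> r => x; apply: (@le_trans _ _ ((linf_rnorm g)%:C%C * `|x|)).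
  by rewrite !rnormE -rmorphM lecR rnorm_diag_le.
apply: ler_wpM2r => //; near: r; apply: nbhs_pinfty_ge.
exact/ger0_real/(eqbRL (lecR _ _))/linf_rnorm_ge0.
Unshelve. all: by end_near. Qed.

Lemma diag_subproof g : diag_fun g \in @bop_pred R (ell2 R).
Proof.
apply/asboolP; split; first exact: diag_fun_linear.
exact: diag_fun_continuous.
Qed.

Definition diag g : bop (ell2 R) := Bop (diag_subproof g).

Lemma diag_linear : linear diag.
Proof.
move=> k g h; apply: bop_eqP => x; apply: ell2_eqP => n.
rewrite -[LHS]/((k * g n + h n) * x n) -[RHS]/(k * (g n * x n) + h n * x n).
by rewrite mulrDl mulrA.
Qed.

HB.instance Definition _ := GRing.isLinear.Build _ _ _ _ diag diag_linear.

Lemma diagM : {morph diag : g h / amul g h}.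
Proof.
move=> g h; apply: bop_eqP => x; apply: ell2_eqP => n.
by rewrite -[LHS]/(g n * h n * x n) -[RHS]/(g n * (h n * x n)) mulrA.
Qed.

Lemma diag_delta g n : diag g (delta R n) n = g n.
Proof. by rewrite -[LHS]/(g n * (n == n)%:R) eqxx mulr1. Qed.

Lemma diag_norm g : `|diag g| = `|g|.
Proof.
rewrite -[LHS]/((bop_rnorm (diag g))%:C%C) -[RHS]/((linf_rnorm g)%:C%C).
congr (_%:C%C); apply/le_anti/andP; split.
  apply: bop_rnorm_le => x; rewrite unit_ballE => x1.
  by rewrite (le_trans (rnorm_diag_le g x))// ler_piMr ?linf_rnorm_ge0.
apply: linf_rnorm_le => n; rewrite -(diag_delta g n).
apply: (@le_trans _ _ (rnorm (diag g (delta R n)))); first exact: ell2_coord_le.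
by apply: bop_rnorm_ub1; rewrite unit_ballE rnorm_delta.
Qed.

(** If c were nonzero, the images u j of the basis vectors at the positions
s j would have a cluster point in the compact closure of the image of the unit
ball, hence two of them would be at distance less than |c|. But u i - u j has
the entry c at the position s i. *)
Lemma compact_diag_eq0 g (c : R[i]) (s : nat -> nat) : injective s ->
  (forall j, g (s j) = c) -> compact_operators (ell2 R) (diag g) -> c = 0.
Proof.
move=> s_inj gs; rewrite /compact_operators /= precompactE => cK.
apply/eqP; apply: contraT => c0.
pose u j : ell2 R := diag g (delta R (s j)).
have [|y [_ uy]] := cK (u @ \oo)%classic _ _.
  exists 0%N => // j _; apply: subset_closure; exists (delta R (s j)) => //=.
  by rewrite unit_ballE rnorm_delta.
have e0 : 0 < `|c| / 2 by rewrite divr_gt0 ?normr_gt0.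
have By : nbhs y (ball y (`|c| / 2)) by exact: nbhsx_ballx.
have near_y N : exists2 j, (N <= j)%N & `|y - u j| < `|c| / 2.
  have [|z [[j /= Nj <-]]] := uy (u @` [set j | (N <= j)%N])%classic _ _ By.
    by exists N => // j Nj; exists j.
  by rewrite -ball_normE /= => yu; exists j.
have [i _ yi] := near_y 0%N; have [j ij yj] := near_y i.+1.
have : `|u i - u j| < `|c|.
  rewrite [ltRHS]splitr; apply: le_lt_trans (ltrD yj yi).
  by rewrite (le_trans _ (ler_normB _ _))// opprB [in leRHS]addrC subrKA.
have -> : c = (u i - u j) (s i).
  rewrite -[RHS]/(g (s i) * (s i == s i)%:R - g (s i) * (s i == s j)%:R).
  by rewrite !gs eqxx (inj_eq s_inj) (ltn_eqF ij) mulr1 mulr0 subr0.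
by rewrite normc_rnorm rnormE ltcR ltNge ell2_coord_le.
Qed.

End diagonal.

(** The partition of the naturals into infinite classes comes from an injection
of the pairs (k, j) into the naturals: [site k j] is the j-th position of the
k-th class, and [label] recovers the class. *)
Definition site (k j : nat) : nat := pickle (k, j).

(* The numbers that encode no pair are put in the class 0. *)
Definition label (n : nat) : nat :=
  if (unpickle n : option (nat * nat)) is Some (k, _) then k else 0%N.

Lemma site_inj k : injective (site k).
Proof. by move=> i j /(pcan_inj pickleK)[]. Qed.

Lemma siteK k j : label (site k j) = k.
Proof. by rewrite /label /site pickleK. Qed.

Section spread.
Variable R : realType.
Implicit Types f g : linf R.

Lemma spread_subproof f : (fun n => f (label n)) \in @linf_pred R.
Proof.
by apply/asboolP/bounded_seqP; exists (linf_rnorm f) => n; exact: linf_rnorm_ub.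
Qed.

Definition spread f : linf R := Linf (spread_subproof f).

Lemma spread_linear : linear spread.
Proof. by move=> k f g; apply: linf_eqP. Qed.

HB.instance Definition _ := GRing.isLinear.Build _ _ _ _ spread spread_linear.

Lemma spreadM : {morph spread : f g / amul f g}.
Proof. by move=> f g; apply: linf_eqP. Qed.

Lemma spread_norm f : `|spread f| = `|f|.
Proof.
rewrite -[LHS]/((linf_rnorm (spread f))%:C%C) -[RHS]/((linf_rnorm f)%:C%C).
congr (_%:C%C); apply/le_anti/andP; split; apply: linf_rnorm_le => n.
  exact: (linf_rnorm_ub f (label n)).
by have := linf_rnorm_ub (spread f) (site n 0%N); rewrite /= siteK.
Qed.

End spread.

Section avoid.
Variable R : realType.

Definition spread_diag : {linear linf R -> bop (ell2 R)} :=
  @diag R \o @spread R.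

Lemma spread_diag_norm f : `|spread_diag f| = `|f|.
Proof. by rewrite /spread_diag /= diag_norm spread_norm. Qed.

Lemma spread_diag_inj : injective spread_diag.
Proof.
apply: raddf_inj => f f0; apply/normr0_eq0.
by rewrite -spread_diag_norm f0 normr0.
Qed.

Lemma compact_spread_diag_eq0 f :
  compact_operators (ell2 R) (spread_diag f) -> f = 0.
Proof.
move=> cf; apply: linf_eqP => k.
apply: (compact_diag_eq0 (site_inj (k := k)) _ cf) => j.
by rewrite /= siteK.
Qed.

Lemma compact_operators0 : compact_operators (ell2 R) 0.
Proof.
rewrite /compact_operators /=; apply: (@precompact_subset _ _ [set 0]%classic).
  by move=> _ [x _ <-].
apply: compact_precompact; last exact: compact_set1.
exact: norm_hausdorff.
Qed.

Lemma range_avoids (V : lmodType R[i]) (phi : {linear V -> linf R}) :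
  (range (spread_diag \o phi) `&` compact_operators (ell2 R) = [set 0])%classic.
Proof.
apply/seteqP; split=> [_ [[v _ <-]] /compact_spread_diag_eq0 v0|_ ->] /=.
  by rewrite v0 !linear0.
by split; [exists 0 => //; rewrite /= !linear0 | exact: compact_operators0].
Qed.

End avoid.

Theorem corollary2p9 (R : realType) :
  (forall A : assocAlgType R[i],
     algebra_embeddable A (linf R) ->
     algebra_embeddable_avoiding A (bop (ell2 R)) (compact_operators (ell2 R))) /\
  (forall X : completeNormedModType R[i],
     banach_embeddable X (linf R) ->
     banach_embeddable_avoiding X (bop (ell2 R)) (compact_operators (ell2 R))).
Proof.
split=> [A|X] [phi [phi_inj phiP]]; exists (spread_diag R \o phi); split.
- split; first exact: inj_comp (@spread_diag_inj R) phi_inj.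
  by move=> x y; rewrite /= phiP spreadM diagM.
- exact: range_avoids.
- split; first exact: inj_comp (@spread_diag_inj R) phi_inj.
  by move=> x; rewrite -[LHS]/(`|spread_diag R (phi x)|) spread_diag_norm phiP.
- exact: range_avoids.
Qed.
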